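(* Let $(\mathfrak g,[\cdot,\cdot]_{\mathfrak g})$ and $(\mathfrak h,[\cdot,\cdot]_{\mathfrak h})$ be Lie algebras, $H:\mathfrak g\to\mathfrak h$ a linear map and $\rho:\mathfrak g\to\mathrm{Der}(\mathfrak h)$ an action of $\mathfrak g$ on $\mathfrak h$. Define $\rho_H:\mathfrak g\to\mathfrak{gl}(\mathfrak h)$ by $\rho_H(x)u=\rho(x)u+[Hx,u]_{\mathfrak h}$ for all $x\in\mathfrak g$, $u\in\mathfrak h$. (a) Suppose that $\rho_H$ is an action of $\mathfrak g$ on $\mathfrak h$. Then the linear map $\hat H:\mathfrak g\ltimes_{\rho_H}\mathfrak h\to\mathfrak g\ltimes_\rho\mathfrak h$ defined by $\hat H(x,u)=(x,Hx+u)$ for all $x\in\mathfrak g,u\in\mathfrak h$ is a Lie algebra isomorphism if and only if $H$ is a crossed homomorphism from $\mathfrak g$ to $\mathfrak h$ with respect to the action $\rho$. (b) $H$ is a crossed homomorphism from $\mathfrak g$ to $\mathfrak h$ with respect to the action $\rho$ if and only if the map $\iota_H:\mathfrak g\to\mathfrak g\ltimes_\rho\mathfrak h$ defined by $\iota_H(x)=(x,Hx)$ for all $x\in\mathfrak g$ is a Lie algebra homomorphism.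
   Context: All vector spaces are over an algebraically closed field $\mathbb K$ of characteristic $0$. An action of $\mathfrak g$ on $\mathfrak h$ is a Lie algebra homomorphism $\rho:\mathfrak g\to\mathrm{Der}(\mathfrak h)$ into the Lie algebra of derivations of $\mathfrak h$. A linear map $H:\mathfrak g\to\mathfrak h$ is a crossed homomorphism with respect to $\rho$ if $H[x,y]_{\mathfrak g}=\rho(x)(Hy)-\rho(y)(Hx)+[Hx,Hy]_{\mathfrak h}$ for all $x,y\in\mathfrak g$. For an action $\rho$, the semidirect product $\mathfrak g\ltimes_\rho\mathfrak h$ is the vector space $\mathfrak g\oplus\mathfrak h$ with bracket $[(x,u),(y,v)]_\rho=([x,y]_{\mathfrak g},\rho(x)v-\rho(y)u+[u,v]_{\mathfrak h})$. *)

(* Defs.v *)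
From HB Require Import structures.
From mathcomp Require Import all_boot ssralg.
From mathcomp Require Import boolp.

Set Implicit Arguments.
Unset Strict Implicit.
Unset Printing Implicit Defensive.

Import GRing.Theory.
Local Open Scope ring_scope.

Reserved Notation "{[ x , y ]}" (at level 0, format "{[ x ,  y ]}").

Fact zmod_sum6 (V : zmodType) (a b c d e f : V) :
  a - b + (d - c) + (c - e + (b - f)) + (f - d + (e - a)) = 0.
Proof.
rewrite [c - e + _]addrC (addrACA (a - b)) !subrKA addrACA !subrKA.
exact: subrr.
Qed.

HB.mixin Record isLieAlgebra (K : fieldType) L of GRing.Lmodule K L := {
  lie_bracket : L -> L -> L;
  lie_linearl : forall y, linear (lie_bracket^~ y);
  lie_linearr : forall x, linear (lie_bracket x);
  lie_alternating : forall x, lie_bracket x x = 0;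
  lie_jacobi : forall x y z,
    lie_bracket x (lie_bracket y z) + lie_bracket y (lie_bracket z x)
      + lie_bracket z (lie_bracket x y) = 0
}.

#[short(type="lieAlgType")]
HB.structure Definition LieAlgebra (K : fieldType) :=
  {L of isLieAlgebra K L & GRing.Lmodule K L}.

Notation "{[ x , y ]}" := (lie_bracket x y) : ring_scope.

Section LieTheory.
Variables (K : fieldType) (L : lieAlgType K).
Implicit Types (x y z : L).

HB.instance Definition _ x :=
  GRing.isLinear.Build K L L *:%R (lie_bracket x) (lie_linearr x).

Lemma lieDl y : {morph (fun x => {[x, y]}) : a b / a + b}.
Proof. by move=> a b; have := lie_linearl y 1 a b; rewrite !scale1r. Qed.
Lemma lieDr x : {morph lie_bracket x : a b / a + b}.
Proof. exact: raddfD. Qed.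
Lemma lie0r x : {[x, 0]} = 0. Proof. exact: raddf0. Qed.
Lemma lieNr x y : {[x, - y]} = - {[x, y]}. Proof. exact: raddfN. Qed.
Lemma lieC x y : {[x, y]} = - {[y, x]}.
Proof.
have := lie_alternating (x + y).
rewrite lieDl !lieDr !lie_alternating add0r addr0 => /eqP.
by rewrite addr_eq0 => /eqP.
Qed.
Lemma lie0l x : {[0, x]} = 0. Proof. by rewrite lieC lie0r oppr0. Qed.
Lemma lieNl x y : {[- x, y]} = - {[x, y]}.
Proof. by rewrite lieC lieNr -lieC. Qed.
Lemma lieBl x y z : {[x - y, z]} = {[x, z]} - {[y, z]}.
Proof. by rewrite lieDl lieNl. Qed.
Lemma lieBr x y z : {[x, y - z]} = {[x, y]} - {[x, z]}.
Proof. by rewrite lieDr lieNr. Qed.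
Lemma lieZr a x y : {[x, a *: y]} = a *: {[x, y]}.
Proof. exact: linearZZ. Qed.
Lemma lieZl a x y : {[a *: x, y]} = a *: {[x, y]}.
Proof. by rewrite lieC lieZr -scalerN -lieC. Qed.

End LieTheory.

Section LieHom.
Variables (K : fieldType) (g h : lieAlgType K).

Definition lie_hom (f : g -> h) : Prop :=
  linear f /\ {morph f : x y / {[x, y]}}.

Definition lie_iso (f : g -> h) : Prop := lie_hom f /\ bijective f.

End LieHom.

Definition gl (K : fieldType) (V : lmodType K) : Type := {linear V -> V}.

Section GL.
Variables (K : fieldType) (V : lmodType K).

Definition gl_fun (f : gl V) : {linear V -> V} := f.
Coercion gl_fun : gl >-> GRing.Linear.type.

Lemma glP (f g : gl V) : f =1 g -> f = g.
Proof.
case: f => f [[m0] [m1]]; case: g => g [[n0] [n1]] /= fg.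
have {}fg : f = g by apply/funext.
case: _ / fg n0 n1 => n0 n1.
by rewrite (Prop_irrelevance m0 n0) (Prop_irrelevance m1 n1).
Qed.

HB.instance Definition _ := gen_eqMixin (gl V).
HB.instance Definition _ := gen_choiceMixin (gl V).

Definition gl_zero : gl V := (\0 : {linear V -> V}).
Definition gl_opp (f : gl V) : gl V := (\- f : {linear V -> V}).
Definition gl_add (f g : gl V) : gl V := (f \+ g : {linear V -> V}).
Definition gl_scale (a : K) (f : gl V) : gl V := (a \*: f : {linear V -> V}).

Fact gl_addA : associative gl_add.
Proof. by move=> f g k; apply/glP => u; exact: addrA. Qed.
Fact gl_addC : commutative gl_add.
Proof. by move=> f g; apply/glP => u; exact: addrC. Qed.
Fact gl_add0 : left_id gl_zero gl_add.
Proof. by move=> f; apply/glP => u; exact: add0r. Qed.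
Fact gl_addN : left_inverse gl_zero gl_opp gl_add.
Proof. by move=> f; apply/glP => u; exact: addNr. Qed.
HB.instance Definition _ :=
  GRing.isZmodule.Build (gl V) gl_addA gl_addC gl_add0 gl_addN.

Fact gl_scaleA a b (f : gl V) : gl_scale a (gl_scale b f) = gl_scale (a * b) f.
Proof. by apply/glP => u; exact: scalerA. Qed.
Fact gl_scale1 : left_id 1 gl_scale.
Proof. by move=> f; apply/glP => u; exact: scale1r. Qed.
Fact gl_scaleDr : right_distributive gl_scale +%R.
Proof. by move=> a f g; apply/glP => u; exact: scalerDr. Qed.
Fact gl_scaleDl f : {morph gl_scale^~ f : a b / a + b}.
Proof. by move=> a b; apply/glP => u; exact: scalerDl. Qed.
HB.instance Definition _ := GRing.Zmodule_isLmodule.Build K (gl V)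
  gl_scaleA gl_scale1 gl_scaleDr gl_scaleDl.

Lemma glDE (f g : gl V) u : (f + g) u = f u + g u. Proof. by []. Qed.
Lemma glNE (f : gl V) u : (- f) u = - f u. Proof. by []. Qed.
Lemma glZE a (f : gl V) u : (a *: f) u = a *: f u. Proof. by []. Qed.
Lemma gl0E u : (0 : gl V) u = 0. Proof. by []. Qed.

Definition gl_comp (f g : gl V) : gl V := (f \o g : {linear V -> V}).
Definition gl_bracket (f g : gl V) : gl V := gl_comp f g - gl_comp g f.

Lemma gl_bracketE f g u : gl_bracket f g u = f (g u) - g (f u).
Proof. by []. Qed.

Fact gl_linearl g : linear (gl_bracket^~ g).
Proof.
move=> a f k; apply/glP => u.
change (a *: f (g u) + k (g u) - g (a *: f u + k u) =
        a *: (f (g u) - g (f u)) + (k (g u) - g (k u))).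
by rewrite linearP scalerBr opprD addrACA.
Qed.
Fact gl_linearr f : linear (gl_bracket f).
Proof.
move=> a g k; apply/glP => u.
change (f (a *: g u + k u) - (a *: g (f u) + k (f u)) =
        a *: (f (g u) - g (f u)) + (f (k u) - k (f u))).
by rewrite linearP scalerBr opprD addrACA.
Qed.
Fact gl_alternating f : gl_bracket f f = 0.
Proof. exact: subrr. Qed.
Fact gl_jacobi x y z :
  gl_bracket x (gl_bracket y z) + gl_bracket y (gl_bracket z x)
    + gl_bracket z (gl_bracket x y) = 0.
Proof.
apply/glP => u.
change (x (y (z u) - z (y u)) - (y (z (x u)) - z (y (x u)))
  + (y (z (x u) - x (z u)) - (z (x (y u)) - x (z (y u))))
  + (z (x (y u) - y (x u)) - (x (y (z u)) - y (x (z u)))) = 0).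
rewrite !(linearB x) !(linearB y) !(linearB z) /= !opprB.
exact: zmod_sum6.
Qed.
HB.instance Definition _ := isLieAlgebra.Build K (gl V)
  gl_linearl gl_linearr gl_alternating gl_jacobi.

Lemma gl_lieE (f g : gl V) u : {[f, g]} u = f (g u) - g (f u).
Proof. by []. Qed.

End GL.

Section Derivations.
Variables (K : fieldType) (h : lieAlgType K).

Definition is_derivation (D : gl h) : Prop :=
  forall u v, D {[u, v]} = {[D u, v]} + {[u, D v]}.

Definition derivation : {pred gl h} := fun D => `[< is_derivation D >].

Fact derivation_submod : submod_closed derivation.
Proof.
split=> [|a D E /asboolP dD /asboolP dE]; apply/asboolP => u v.
  by rewrite !gl0E lie0l lie0r addr0.
rewrite !glDE !glZE dD dE lieDl lieDr lieZl lieZr scalerDr.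
exact: addrACA.
Qed.
HB.instance Definition _ :=
  GRing.isSubmodClosed.Build K (gl h) derivation derivation_submod.

Record Der := MkDer { der_val : gl h; _ : der_val \in derivation }.
HB.instance Definition _ := [isSub for der_val].
HB.instance Definition _ := [Choice of Der by <:].
HB.instance Definition _ := [SubChoice_isSubLmodule of Der by <:].

Coercion der_val : Der >-> gl.

Lemma DerP (D : Der) u v : D {[u, v]} = {[D u, v]} + {[u, D v]}.
Proof. by have /asboolP := valP D; apply. Qed.

Fact derivation_bracket (D E : gl h) :
  D \in derivation -> E \in derivation -> {[D, E]} \in derivation.
Proof.
move=> /asboolP dD /asboolP dE; apply/asboolP => u v.
rewrite !gl_lieE dE dD (linearD D) (linearD E) /= !dE !dD lieBl lieBr.
set a := {[D (E u), v]}; set b := {[E u, D v]}; set c := {[D u, E v]}.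
set d := {[u, D (E v)]}; set a' := {[E (D u), v]}; set d' := {[u, E (D v)]}.
rewrite [c + d]addrC addrACA [b + d']addrC (addrACA a') [c + b]addrC.
by rewrite opprD (addrACA (a + d)) subrr addr0 opprD addrACA.
Qed.

Definition Der_bracket (D E : Der) : Der :=
  MkDer (derivation_bracket (valP D) (valP E)).

Fact Der_linearl E : linear (Der_bracket^~ E).
Proof. by move=> a D F; apply/val_inj; exact: lie_linearl. Qed.
Fact Der_linearr D : linear (Der_bracket D).
Proof. by move=> a E F; apply/val_inj; exact: lie_linearr. Qed.
Fact Der_alternating D : Der_bracket D D = 0.
Proof. by apply/val_inj; exact: lie_alternating. Qed.
Fact Der_jacobi D E F :
  Der_bracket D (Der_bracket E F) + Der_bracket E (Der_bracket F D)
    + Der_bracket F (Der_bracket D E) = 0.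
Proof. by apply/val_inj; exact: lie_jacobi. Qed.
HB.instance Definition _ := isLieAlgebra.Build K Der
  Der_linearl Der_linearr Der_alternating Der_jacobi.

Lemma Der_lieE (D E : Der) u : {[D, E]} u = D (E u) - E (D u).
Proof. by []. Qed.
Lemma DerDE (D E : Der) u : (D + E) u = D u + E u. Proof. by []. Qed.
Lemma DerZE a (D : Der) u : (a *: D) u = a *: D u. Proof. by []. Qed.

End Derivations.

Record action (K : fieldType) (g h : lieAlgType K) := MkAction {
  act_fun :> g -> Der h;
  act_hom : lie_hom act_fun
}.

Section Action.
Variables (K : fieldType) (g h : lieAlgType K) (rho : action g h).

Lemma actP a x y u : rho (a *: x + y) u = a *: rho x u + rho y u.
Proof. by have [lin _] := act_hom rho; rewrite lin. Qed.
Lemma act_lie x y u : rho {[x, y]} u = rho x (rho y u) - rho y (rho x u).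
Proof. by have [_ hom] := act_hom rho; rewrite hom. Qed.
Lemma actD x y u : rho (x + y) u = rho x u + rho y u.
Proof. by have := actP 1 x y u; rewrite !scale1r. Qed.

Definition crossed_hom (H : {linear g -> h}) : Prop :=
  forall x y, H {[x, y]} = rho x (H y) - rho y (H x) + {[H x, H y]}.

(* The underlying vector space is g * h; the alias carries the action, on
   which the bracket depends. *)
Definition semidirect (r : action g h) : Type := (g * h)%type.

HB.instance Definition _ := GRing.Lmodule.copy (semidirect rho) (g * h)%type.

Implicit Types p q : semidirect rho.

Definition semidirect_bracket p q : semidirect rho :=
  ({[p.1, q.1]}, rho p.1 q.2 - rho q.1 p.2 + {[p.2, q.2]}).

Fact semidirect_linearl q : linear (semidirect_bracket^~ q).
Proof.
move=> a [x u] [y v]; case: q => z w.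
change (semidirect_bracket (a *: x + y, a *: u + v) (z, w) =
  (a *: {[x, z]} + {[y, z]},
   a *: (rho x w - rho z u + {[u, w]}) + (rho y w - rho z v + {[v, w]}))).
rewrite /semidirect_bracket /= !lieDl !lieZl actP linearP /=; congr pair.
rewrite !scalerDr scalerN opprD.
by rewrite (addrACA _ _ (- _)) (addrACA _ _ (_ *: {[u, w]})).
Qed.

Fact semidirect_alternating p : semidirect_bracket p p = 0.
Proof. by case: p => x u; congr pair; rewrite /= ?lie_alternating ?subrr ?addr0. Qed.

Fact semidirect_bracketC p q :
  semidirect_bracket p q = - semidirect_bracket q p.
Proof.
case: p => x u; case: q => y v.
change (({[x, y]}, rho x v - rho y u + {[u, v]}) =
        (- {[y, x]}, - (rho y u - rho x v + {[v, u]}))).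
by rewrite opprD opprB -!lieC.
Qed.

Fact semidirect_linearr p : linear (semidirect_bracket p).
Proof.
move=> a q r; rewrite semidirect_bracketC semidirect_linearl opprD -scalerN.
by rewrite -!semidirect_bracketC.
Qed.

Fact semidirect_jacobi p q r :
  semidirect_bracket p (semidirect_bracket q r)
    + semidirect_bracket q (semidirect_bracket r p)
    + semidirect_bracket r (semidirect_bracket p q) = 0.
Proof.
case: p => x u; case: q => y v; case: r => z w.
pose S (x y z : g) (u v w : h) := rho x (rho y w - rho z v + {[v, w]})
  - rho {[y, z]} u + {[u, rho y w - rho z v + {[v, w]}]}.
change (({[x, {[y, z]}]} + {[y, {[z, x]}]} + {[z, {[x, y]}]},
  S x y z u v w + S y z x v w u + S z x y w u v) = 0).
have SE x' y' z' u' v' w' : S x' y' z' u' v' w' =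
    (rho x' (rho y' w') - rho x' (rho z' v')
       + (rho z' (rho y' u') - rho y' (rho z' u')))
    + (({[v', rho x' w']} - {[w', rho x' v']})
         + ({[u', rho y' w']} - {[u', rho z' v']}))
    + {[u', {[v', w']}]}.
  rewrite /S act_lie linearD linearB lieDr lieBr DerP opprB.
  by rewrite [X in X + {[v', _]}]lieC (addrC (- _)) addrAC addrAC [X in X + _ = _]addrAC !addrA.
have add3 (p1 q1 r1 p2 q2 r2 p3 q3 r3 : h) :
    p1 + q1 + r1 + (p2 + q2 + r2) + (p3 + q3 + r3)
    = p1 + p2 + p3 + (q1 + q3 + q2) + (r1 + r2 + r3).
  by rewrite (addrACA _ r1) (addrACA p1) (addrACA _ (r1 + r2))
    (addrACA (p1 + p2)) (addrAC q1).
by rewrite !SE add3 !zmod_sum6 !lie_jacobi !addr0.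
Qed.

HB.instance Definition _ := isLieAlgebra.Build K (semidirect rho)
  semidirect_linearl semidirect_linearr semidirect_alternating semidirect_jacobi.

Lemma semidirectE x u y v :
  {[(x, u) : semidirect rho, (y, v) : semidirect rho]} =
  ({[x, y]}, rho x v - rho y u + {[u, v]}).
Proof. by []. Qed.

End Action.

Section Twist.
Variables (K : fieldType) (g h : lieAlgType K).
Variables (rho : action g h) (H : {linear g -> h}).

Definition rho_tw (x : g) : gl h :=
  (rho x : gl h) + (lie_bracket (H x) : {linear h -> h}).

Lemma rho_twE x u : rho_tw x u = rho x u + {[H x, u]}.
Proof. by []. Qed.

Definition Hhat (rhoH : action g h) (p : semidirect rhoH) : semidirect rho :=
  (p.1, H p.1 + p.2).

Definition iota_graph (x : g) : semidirect rho := (x, H x).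

End Twist.

(* Main.v *)
Require Import Defs.
From mathcomp Require Import all_boot ssralg.
Import GRing.Theory.
Local Open Scope ring_scope.

(* The bracket in the semidirect product by rho of (x, H x + u) and (y, H y + v)
   has as second component the right-hand side of the crossed homomorphism
   equation at (x, y) plus the second component of the bracket of (x, u) and
   (y, v) twisted by H. Cancelling the latter gives (a); u = v = 0 gives (b). *)

Section GraphOfCrossedHom.
Variables (K : fieldType) (g h : lieAlgType K).
Variables (rho : action g h) (H : {linear g -> h}).

Lemma twisted_bracketE (x y : g) (u v : h) :
  rho x (H y + v) - rho y (H x + u) + {[H x + u, H y + v]} =
  (rho x (H y) - rho y (H x) + {[H x, H y]})
    + (rho_tw rho H x v - rho_tw rho H y u + {[u, v]}).
Proof.
(* Antisymmetry turns [{[u, H y]}] into [- {[H y, u]}], the correction that twists [rho y u]. *)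
rewrite !rho_twE !linearD /= !lieDl (lieC u (H y)).
by rewrite [LHS](AC (2*2*(2*2)) ((1*3*5)*((2*7)*(4*6)*8))).
Qed.

Lemma iota_graph_lie_homP : lie_hom (iota_graph rho H) <-> crossed_hom rho H.
Proof.
(* By computation, the second components give exactly the crossed homomorphism equation. *)
split=> [[_ morphH] x y | crossH]; first by case: (morphH x y).
split=> [a x y | x y]; first by rewrite /iota_graph linearP.
by rewrite /iota_graph crossH.
Qed.

Variable rhoH : action g h.
Hypothesis rhoHE : forall x : g, rhoH x = rho_tw rho H x :> gl h.

Lemma Hhat_linear : linear (Hhat rho H (rhoH := rhoH)).
Proof.
move=> a [x u] [y v]; congr pair; rewrite /= linearP scalerDr.
exact: addrACA.
Qed.

Lemma Hhat_bij : bijective (Hhat rho H (rhoH := rhoH)).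
Proof.
exists (fun p => (p.1, p.2 - H p.1)) => [[x u] | [x u]]; congr pair => /=.
  by rewrite addrC addKr.
by rewrite addrC subrK.
Qed.

Lemma Hhat_lie_morphP :
  {morph Hhat rho H (rhoH := rhoH) : p q / {[p, q]}} <-> crossed_hom rho H.
Proof.
split=> [morphH x y | crossH [x u] [y v]].
  (* The twisted summand at [u = v = 0] ends both sides and cancels unevaluated. *)
  case: (morphH (x, 0) (y, 0)); rewrite twisted_bracketE.
  by rewrite !rhoHE => /addIr.
by congr pair; rewrite /= twisted_bracketE !rhoHE crossH.
Qed.

(** [Hhat] is a linear bijection in any case, so only compatibility with brackets is at stake. *)
Lemma Hhat_lie_isoP :
  lie_iso (Hhat rho H (rhoH := rhoH)) <-> crossed_hom rho H.
Proof.
split=> [[[_ /Hhat_lie_morphP]] // | /Hhat_lie_morphP morphH].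
by split; [split; [exact: Hhat_linear |] | exact: Hhat_bij].
Qed.

End GraphOfCrossedHom.

Theorem theorem2p7 (K : closedFieldType) (charK0 : [pchar K] =i pred0)
    (g h : lieAlgType K) (H : {linear g -> h}) (rho : action g h) :
  (* (a): rhoH witnesses that rho_tw rho H is an action *)
  (forall rhoH : action g h,
     (forall x : g, rhoH x = rho_tw rho H x :> gl h) ->
     (lie_iso (Hhat rho H (rhoH := rhoH)) <-> crossed_hom rho H))
  /\
  (* (b) *)
  (crossed_hom rho H <-> lie_hom (iota_graph rho H)).
Proof.
split; first exact: Hhat_lie_isoP.
exact: iff_sym (iota_graph_lie_homP _ _ _ _ _).
Qed.
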